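(* For every integer $r\ge 4$ let $\mathscr{P}_{D_r}(q)$ be the $q$-analog of Kostant's partition function evaluated at the highest root of type $D_r$ (defined in the context). Then, as formal power series in $x$ with coefficients in $\mathbb{Z}[q]$, \[ \sum_{r \geq 4} \mathscr{P}_{D_r}(q)x^r = \dfrac{(q+4q^2+6q^3+3q^4+q^5)x^4 - (q+4q^2+6q^3+5q^4+3q^5+q^6)x^5}{1-(2+2q+q^2)x+(1+2q+q^2+q^3)x^2}. \]
   Context: Type $D_r$ (the Lie algebra $\mathfrak{so}_{2r}(\mathbb{C})$), $r\ge4$: with simple roots $\alpha_1,\dots,\alpha_r$, where $\alpha_{r-2}$ is the branch node joined to $\alpha_{r-3},\alpha_{r-1},\alpha_r$, the positive roots are $\alpha_i+\alpha_{i+1}+\cdots+\alpha_j$ for $1\le i\le j\le r-1$; $\alpha_r$; $\alpha_i+\cdots+\alpha_{r-2}+\alpha_r$ for $1\le i\le r-2$; $\alpha_i+\cdots+\alpha_{r-2}+\alpha_{r-1}+\alpha_r$ for $1\le i\le r-2$; and $\alpha_i+\cdots+\alpha_{j-1}+2\alpha_j+\cdots+2\alpha_{r-2}+\alpha_{r-1}+\alpha_r$ for $1\le i<j\le r-2$. The highest root is $\tilde\alpha=\alpha_1+2\alpha_2+\cdots+2\alpha_{r-2}+\alpha_{r-1}+\alpha_r$. A partition of $\tilde\alpha$ with $k$ parts is a multiset of $k$ positive roots (repetitions allowed) summing to $\tilde\alpha$. Then $\mathscr{P}_{D_r}(q)=\sum_{k\ge1}a_kq^k$, where $a_k$ is the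 number of partitions of $\tilde\alpha$ with exactly $k$ parts. *)

(* Defs.v *)
From HB Require Import structures.
From mathcomp Require Import all_boot all_order all_algebra.
From mathcomp Require Import zify.
Set Implicit Arguments.
Unset Strict Implicit.
Unset Printing Implicit Defensive.
Import Order.TTheory GRing.Theory Num.Theory.
Local Open Scope ring_scope.

(* Formal power series over R, as coefficient sequences; equality is [=1]. *)
Definition fps (R : Type) := nat -> R.

Section PowerSeries.
Variable R : comUnitRingType.
Implicit Types f g : fps R.

Definition fps_of_poly (p : {poly R}) : fps R := fun n => p`_n.

Definition fps_mul f g : fps R := fun n => \sum_(i < n.+1) f i * g (n - i)%N.

(* The first n coefficients of f^-1, from the recursion
     (f^-1)_0 = f_0^-1,
     (f^-1)_n = - f_0^-1 * \sum_(i < n) f_(n-i) * (f^-1)_i. *)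
Fixpoint fps_inv_prefix f (n : nat) : seq R :=
  if n is n'.+1 then
    let s := fps_inv_prefix f n' in
    rcons s (if n' == 0%N then (f 0%N)^-1
             else - (f 0%N)^-1 * \sum_(i < n') f (n' - i)%N * s`_i)
  else [::].

(* Meaningful when f 0 is a unit, see fps_mulfV. *)
Definition fps_inv f : fps R := fun n => (fps_inv_prefix f n.+1)`_n.

Definition fps_div f g : fps R := fps_mul f (fps_inv g).

Lemma size_fps_inv_prefix f n : size (fps_inv_prefix f n) = n.
Proof. by elim: n => //= n IHn; rewrite size_rcons IHn. Qed.

Lemma nth_fps_inv_prefix f n i :
  (i < n)%N -> (fps_inv_prefix f n)`_i = fps_inv f i.
Proof.
elim: n => // n IHn; rewrite ltnS leq_eqVlt => /orP[/eqP-> // | lt_in].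
by rewrite [fps_inv_prefix f _]/= nth_rcons size_fps_inv_prefix lt_in IHn.
Qed.

Lemma fps_inv0 f : fps_inv f 0 = (f 0%N)^-1.
Proof. by []. Qed.

Lemma fps_invS f n :
  fps_inv f n.+1 =
  - (f 0%N)^-1 * \sum_(i < n.+1) f (n.+1 - i)%N * fps_inv f i.
Proof.
rewrite /fps_inv [fps_inv_prefix f n.+2]/=.
rewrite -/(fps_inv_prefix f n.+1) nth_rcons size_rcons size_fps_inv_prefix.
rewrite ltnn eqxx; congr (_ * _); apply: eq_bigr => i _; congr (_ * _).
exact: nth_fps_inv_prefix.
Qed.

Lemma fps_mulfV f : f 0%N \is a GRing.unit ->
  fps_mul f (fps_inv f) =1 fps_of_poly 1.
Proof.
move=> uf [|n]; rewrite /fps_mul /fps_of_poly coef1.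
  by rewrite big_ord_recl big_ord0 addr0 fps_inv0 divrr.
rewrite big_ord_recl subn0 fps_invS mulNr mulrN mulrA divrr // mul1r.
apply/eqP; rewrite addrC subr_eq0 (reindex_inj rev_ord_inj) /=.
apply/eqP/eq_bigr => i _; rewrite /bump /= add1n !subSS.
by have lti := ltn_ord i; congr (f _ * fps_inv f _); lia.
Qed.

End PowerSeries.

(* The simple root alpha_i of D_r, for 1 <= i <= r, in Z^r with the simple
   roots as basis; alpha r i = 0 for any other i. *)
Definition alpha (r i : nat) : 'rV[int]_r := \row_(m < r) (m.+1 == i)%:R.

Definition posrootsD (r : nat) : seq 'rV[int]_r :=
     [seq \sum_(i <= m < j.+1) alpha r m
        | i <- index_iota 1 r, j <- index_iota i r]
  ++ [:: alpha r r]
  ++ [seq \sum_(i <= m < r.-1) alpha r m + alpha r r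
        | i <- index_iota 1 r.-1]
  ++ [seq \sum_(i <= m < r.-1) alpha r m + alpha r r.-1 + alpha r r
        | i <- index_iota 1 r.-1]
  ++ [seq \sum_(i <= m < j) alpha r m + \sum_(j <= m < r.-1) alpha r m *+ 2
            + alpha r r.-1 + alpha r r
        | i <- index_iota 1 r.-1, j <- index_iota i.+1 r.-1].

Definition highest_rootD (r : nat) : 'rV[int]_r :=
  alpha r 1 + \sum_(2 <= m < r.-1) alpha r m *+ 2 + alpha r r.-1 + alpha r r.

(* A multiset of k positive roots is encoded by its multiplicity function,
   whose values are at most k. *)
Definition partitionsD (r k : nat)
    : {set {ffun seq_sub (posrootsD r) -> 'I_k.+1}} :=
  [set m : {ffun seq_sub (posrootsD r) -> 'I_k.+1} |
     (\sum_b (m b : nat) == k)%N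
     && (\sum_b ssval b *+ m b == highest_rootD r)].

(* The height of the highest root is 2r - 3, hence there are no partitions with
   more parts, see partitionsD_eq0. *)
Definition kostantD (r : nat) : {poly int} :=
  \sum_(1 <= k < (2 * r - 3).+1) #|partitionsD r k|%:R * 'X^k.

Definition height (r : nat) (v : 'rV[int]_r) : int := \sum_m v 0 m.

Lemma heightD r : {morph @height r : u v / u + v}.
Proof.
by move=> u v; rewrite /height -big_split; apply: eq_bigr => m _; rewrite mxE.
Qed.

Lemma height0 r : @height r 0 = 0.
Proof. by rewrite /height big1 // => m _; rewrite mxE. Qed.

Lemma heightMn r (v : 'rV[int]_r) n : height (v *+ n) = height v *+ n.
Proof.
by elim: n => [|n IHn]; rewrite ?mulr0n ?height0 // !mulrS heightD IHn.
Qed.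

Lemma height_sum r (I : Type) (s : seq I) (F : I -> 'rV[int]_r) :
  height (\sum_(i <- s) F i) = \sum_(i <- s) height (F i).
Proof. by apply: big_morph; [exact: heightD | exact: height0]. Qed.

Lemma height_alpha r i : (0 < i <= r)%N -> height (alpha r i) = 1.
Proof.
case: i => // i /= lt_ir; rewrite /height (bigD1 (Ordinal lt_ir)) //= mxE eqxx.
rewrite big1 ?addr0 // => m; rewrite mxE eqSS -val_eqE /= => /negPf-> //.
Qed.

Lemma height_sum_alpha r i j : (0 < i)%N -> (j <= r.+1)%N ->
  height (\sum_(i <= m < j) alpha r m) = (j - i)%N%:R.
Proof.
move=> i_gt0 le_jr; rewrite height_sum big_nat_cond.
rewrite (eq_bigr (fun=> 1)) ?sumr_const_nat -?big_nat_cond ?sumr_const_nat //.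
by move=> m /andP[/andP[im mj] _]; rewrite height_alpha //; lia.
Qed.

Lemma height_sum_alpha2 r i j : (0 < i)%N -> (j <= r.+1)%N ->
  height (\sum_(i <= m < j) alpha r m *+ 2) = (2 * (j - i))%N%:R.
Proof.
by move=> *; rewrite sumrMnl heightMn height_sum_alpha // mul2n -muln2 mulrnA.
Qed.

Lemma height_highest_rootD r : (4 <= r)%N ->
  height (highest_rootD r) = (2 * r - 3)%N%:R.
Proof.
move=> r4; rewrite !heightD height_sum_alpha2 ?height_alpha; try lia.
Qed.

Lemma height_posrootsD r (b : 'rV[int]_r) : (4 <= r)%N ->
  b \in posrootsD r -> 1 <= height b.
Proof.
move=> r4; rewrite !mem_cat inE => /or4P[|/eqP->|/mapP[i]|/orP[/mapP[i]|]].
- case/allpairsPdep=> i [j [+ + ->]]; rewrite !mem_index_iota => *.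
  by rewrite height_sum_alpha; lia.
- by rewrite height_alpha; lia.
- rewrite mem_index_iota => ? ->.
  by rewrite heightD height_sum_alpha ?height_alpha; lia.
- rewrite mem_index_iota => ? ->.
  by rewrite !heightD height_sum_alpha ?height_alpha; lia.
case/allpairsPdep=> i [j [+ + ->]]; rewrite !mem_index_iota => *.
by rewrite !heightD height_sum_alpha ?height_sum_alpha2 ?height_alpha; lia.
Qed.

Lemma partitionsD_eq0 r k : (4 <= r)%N -> (2 * r - 3 < k)%N ->
  partitionsD r k = set0.
Proof.
move=> r4 lt_k; apply/setP => m; rewrite !inE; apply/negP => /andP[/eqP mk].
move=> /eqP/(congr1 (@height r)); rewrite height_highest_rootD // height_sum.
move=> ht; have: (k%:R : int) <= (2 * r - 3)%N%:R.
  rewrite -ht -[in leLHS]mk natr_sum; apply: ler_sum => b _.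
  by rewrite heightMn lerMn2r height_posrootsD ?orbT //; exact: ssvalP.
by rewrite ler_nat leqNgt lt_k.
Qed.

(* Main.v *)
(* Number the nodes of D_r from the fork: the end nodes are e_0 and b, followed
   by e_1, e_2, ..., e_(r-2) (the node alpha_1). A partition of the highest root
   is read along the chain from alpha_1 towards the fork. On every node of
   coefficient 2 it has either one root of coefficient 2, and then its
   continuation is forced, or two roots of coefficient 1, which are
   distinguishable (they have different starting nodes) or equal so far. On the
   next node each of the two roots may continue or be replaced by a new root.
   Counting the possible continuations by the number of new roots, with D_n for
   two distinguishable and S_n for two equal roots, gives
     D_(n+1) = (1 + 2 q) D_n + q^2 S_n + 2,
     S_(n+1) = q D_n + (1 + q^2) S_n + 1,
   and the partition function at the highest root is q F_(r-3), where
     F_(n+1) = q D_n + q^2 S_n + 1.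
   The matrix of this system has trace 2 + 2 q + q^2 and determinant
   1 + 2 q + q^2 + q^3. Its fixed point D = - 1 / q, S = 0 yields F = 0, so that
   F satisfies the homogeneous recurrence of the denominator. *)

From HB Require Import structures.
Require Import Defs.
From mathcomp Require Import all_boot all_order all_algebra.
From mathcomp Require Import zify ring.
Import Order.TTheory GRing.Theory Num.Theory.
Local Open Scope ring_scope.

(** * Multisets of vectors counted by size and sum *)

Section KostantPartitionFunction.
Variable V : zmodType.
Implicit Types (L B : seq V) (b v : V) (k : nat).

(* The number of multisets of k elements of L (assumed duplicate-free) with
   sum v, see card_multisets. *)
Fixpoint kpf L : nat -> V -> int :=
  if L is b :: L' then
    fix kpf_b k v := kpf L' k v + (if k is k'.+1 then kpf_b k' (v - b) else 0)
  else fun k v => ((k == 0%N) && (v == 0))%:R.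

Arguments kpf : simpl never.

Lemma kpf_nil k v : kpf [::] k v = ((k == 0%N) && (v == 0))%:R.
Proof. by []. Qed.

Lemma kpf_cons0 b L v : kpf (b :: L) 0 v = kpf L 0 v.
Proof. exact: addr0. Qed.

Lemma kpf_consS b L k v :
  kpf (b :: L) k.+1 v = kpf L k.+1 v + kpf (b :: L) k (v - b).
Proof. by []. Qed.

(* A multiset with support in s, encoded by its multiplicities, which are
   bounded by any N >= k. *)
Definition multisets (I : finType) (g : I -> V) (N : nat) (s : seq I) k v
    : {set {ffun I -> 'I_N.+1}} :=
  [set m : {ffun I -> 'I_N.+1} | [forall i, (i \notin s) ==> (m i == ord0)]
     && ((\sum_i (m i : nat) == k)%N && (\sum_i g i *+ m i == v))].

Arguments multisets {I} g N s k v.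

(** The left side satisfies the recursion of [kpf]: a multiset supported on [a :: s] either avoids
    [a] or arises uniquely by adding a copy of [a] to a multiset with one element fewer. *)
Lemma card_multisets (I : finType) (g : I -> V) (N : nat) (s : seq I) k v :
  uniq s -> (k <= N)%N ->
  #|multisets g N s k v|%:R = kpf [seq g i | i <- s] k v.
Proof.
elim: s k v => [|a s IHs] k v.
  move=> _ _; rewrite kpf_nil.
  have m0 (m : {ffun I -> 'I_N.+1}) :
      [forall i, (i \notin [::]) ==> (m i == ord0)] -> m = [ffun => ord0].
    by move=> /forallP/= m0; apply/ffunP => i; rewrite ffunE; apply/eqP/m0.
  have S0 : (\sum_i (([ffun => ord0] : {ffun I -> 'I_N.+1}) i : nat) = 0)%N.
    by rewrite big1 // => i _; rewrite ffunE.
  have G0 : \sum_i g i *+ ([ffun => ord0] : {ffun I -> 'I_N.+1}) i = 0.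
    by rewrite big1 // => i _; rewrite ffunE.
  congr (_%:R); case: (boolP (_ && _)) => [/andP[/eqP-> /eqP->]|kv].
    rewrite -[RHS](cards1 ([ffun => ord0] : {ffun I -> 'I_N.+1})).
    apply: eq_card => m; rewrite !inE; apply/idP/eqP => [/andP[/m0//]|->].
    rewrite S0 G0 !eqxx !andbT; apply/forallP => i.
    by rewrite ffunE eqxx implybT.
  apply: eq_card0 => m; rewrite !inE; apply/negP => /andP[/m0-> /andP[]].
  by rewrite S0 G0 => k0 v0; move: kv; rewrite eq_sym k0 eq_sym v0.
move=> /= /andP[nas us]; elim: k v => [|k IHk] v leN.
  rewrite kpf_cons0 -(IHs _ _ us leN).
  congr (_%:R); apply: eq_card => m; rewrite !inE !andbA; congr (_ && _).
  apply/andP/andP => -[/forallP ms /eqP m0]; split; rewrite ?m0 //.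
    apply/forallP => i; apply/implyP => _.
    by have /eqP := m0; rewrite sum_nat_eq0 => /forallP/(_ i).
  apply/forallP => i; apply/implyP; rewrite inE negb_or => /andP[_ +].
  by apply/implyP.
rewrite kpf_consS -(IHs _ _ us leN) -(IHk _ (ltnW leN)) -natrD; congr (_%:R).
rewrite -(cardsID [set m : {ffun I -> 'I_N.+1} | m a == ord0]); congr (_ + _)%N.
  apply: eq_card => m; rewrite !inE andbAC; congr (_ && _).
  apply/andP/forallP => [[/forallP ms ma] i|ms].
    apply/implyP => nis; have [->//|nia] := eqVneq i a.
    by have /implyP := ms i; apply; rewrite inE negb_or nia.
  split; last by have /implyP := ms a; apply.
  apply/forallP => i; apply/implyP; rewrite inE negb_or => /andP[_].
  exact/implyP.
(* Adding a copy of [a] respects the bound: multiplicities are at most [k], and [k < N], so [inord]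
   keeps the value. *)
pose up (m : {ffun I -> 'I_N.+1}) : {ffun I -> 'I_N.+1} :=
  [ffun i => inord (m i + (i == a))].
have le_mk k' v' m i : m \in multisets g N (a :: s) k' v' -> (m i <= k')%N.
  by rewrite inE => /and3P[_ /eqP<- _]; rewrite (bigD1 i) //= leq_addr.
have upE v' m i :
    m \in multisets g N (a :: s) k v' -> up m i = (m i + (i == a))%N :> nat.
  move=> /(le_mk _ _ _ i) lemk; rewrite ffunE inordK //.
  by rewrite ltnS (leq_trans (leq_add lemk (leq_b1 _))) // addn1.
have sum_a : (\sum_i (i == a) = 1)%N.
  by rewrite (bigD1 a) //= eqxx big1 // => i /negPf->.
have gsum_a : \sum_i g i *+ (i == a) = g a.
  by rewrite (bigD1 a) //= eqxx big1 ?addr0 // => i /negPf->.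
have up_inj : {in multisets g N (a :: s) k (v - g a) &, injective up}.
  move=> m m' mP m'P eq_up; apply/ffunP => i; apply: val_inj => /=.
  by apply/(@addIn (i == a)); rewrite -!(upE (v - g a)) ?eq_up.
rewrite -(card_in_imset up_inj); apply: eq_card => m; rewrite inE.
apply/andP/imsetP => [[ma mP]|[m' m'P ->]]; last first.
  split.
    by rewrite inE -val_eqE /= (upE _ _ _ m'P) eqxx addn1.
  have := m'P; rewrite !inE => /and3P[/forallP ms /eqP mk /eqP mv].
  apply/and3P; split.
  - apply/forallP => i; apply/implyP => nis.
    rewrite -val_eqE /= (upE _ _ _ m'P).
    have /eqP-> := implyP (ms i) nis.
    by move: nis; rewrite inE negb_or => /andP[/negPf-> _].
  - under eq_bigr => i _ do rewrite (upE _ _ _ m'P).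
    by rewrite big_split /= mk sum_a addn1.
  - under eq_bigr => i _ do rewrite (upE _ _ _ m'P) mulrnDr.
    by rewrite big_split /= mv gsum_a subrK.
(* The preimage under [up]; the truncated subtraction is exact because [a] occurs in [m]. *)
pose m' : {ffun I -> 'I_N.+1} := [ffun i => inord (m i - (i == a))].
have m'E i : m' i = (m i - (i == a))%N :> nat.
  by rewrite ffunE inordK // ltnS (leq_trans (leq_subr _ _)) // -ltnS.
have mE i : (m i : nat) = (m' i + (i == a))%N.
  rewrite m'E subnK //; have [->|//] := eqVneq i a.
  by move: ma; rewrite inE -val_eqE /= lt0n.
have m'P : m' \in multisets g N (a :: s) k (v - g a).
  move: mP; rewrite !inE => /and3P[/forallP ms mk mv]; apply/and3P; split.
  - apply/forallP => i; apply/implyP => nis.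
    by rewrite -val_eqE /= m'E; have /eqP-> := implyP (ms i) nis.
  - move: mk; under eq_bigr => i _ do rewrite mE.
    by rewrite big_split /= sum_a addn1 eqSS.
  - move: mv; under eq_bigr => i _ do rewrite mE mulrnDr.
    by rewrite big_split /= gsum_a eq_sym -subr_eq eq_sym.
exists m' => //; apply/ffunP => i; apply: val_inj => /=.
by rewrite (upE _ _ _ m'P) mE.
Qed.

(** An additive function that is nonnegative on [L] is nonnegative on every sum of elements of
    [L]. *)
Lemma kpf_lt0 (c : {additive V -> int}) L k v :
  {in L, forall b, 0 <= c b} -> c v < 0 -> kpf L k v = 0.
Proof.
elim: L k v => [|b L IHL] k v c_ge0 cv.
  rewrite kpf_nil; case: (v =P 0) cv => [->|]; last by rewrite andbF.
  by rewrite raddf0 ltxx.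
have cL : {in L, forall b, 0 <= c b}.
  by move=> x xL; rewrite c_ge0 ?inE ?xL ?orbT.
elim: k v cv => [|k IHk] v cv; first by rewrite kpf_cons0 IHL.
rewrite kpf_consS IHL // add0r IHk // raddfB /=.
by rewrite subr_lt0 (lt_le_trans cv) ?c_ge0 ?mem_head.
Qed.

Lemma kpf_neq0 (c : {additive V -> int}) L k v :
  {in L, forall b, c b = 0} -> c v != 0 -> kpf L k v = 0.
Proof.
elim: L k v => [|b L IHL] k v c0 cv.
  rewrite kpf_nil; case: (v =P 0) cv => [->|]; last by rewrite andbF.
  by rewrite raddf0 eqxx.
have cL : {in L, forall b, c b = 0} by move=> x xL; rewrite c0 ?inE ?xL ?orbT.
elim: k v cv => [|k IHk] v cv; first by rewrite kpf_cons0 IHL.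
by rewrite kpf_consS IHL // add0r IHk // raddfB /= (c0 b) ?mem_head ?subr0.
Qed.

(* The sum of f over the two-element multisets of the elements of B. *)
Fixpoint sum_pairs (f : V -> int) B : int :=
  if B is b :: B' then \sum_(x <- B) f (b + x) + sum_pairs f B' else 0.

Lemma eq_sum_pairs f g B :
  {in B &, forall x y, f (x + y) = g (x + y)} -> sum_pairs f B = sum_pairs g B.
Proof.
elim: B => //= b B IHB fg; congr (_ + _).
  by apply: eq_big_seq => x xB; rewrite fg ?mem_head.
by apply: IHB => x y xB yB; rewrite fg ?inE ?xB ?yB ?orbT.
Qed.

Lemma sum_pairs_shift f e B :
  sum_pairs f [seq e + x | x <- B] = sum_pairs (fun w => f (e *+ 2 + w)) B.
Proof.
elim: B => //= b B <-; rewrite !big_cons big_map mulr2n.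
by congr (_ + _ + _); [|apply: eq_bigr => x _]; rewrite addrACA.
Qed.

(* On the node with coordinate function c, the roots in B have coefficient 1 and
   those in L vanish, hence a partition of v uses exactly c v roots from B. *)
Lemma kpf_layer0 (c : {additive V -> int}) B L k v :
  {in B, forall b, c b = 1} -> {in L, forall b, c b = 0} ->
  c v = 0 -> kpf (B ++ L) k v = kpf L k v.
Proof.
move=> + cL cv; elim: B k => //= b B IHB k cB.
have cB' : {in B, forall b, c b = 1} by move=> x xB; rewrite cB ?inE ?xB ?orbT.
case: k => [|k]; first by rewrite kpf_cons0 IHB.
rewrite kpf_consS IHB // (kpf_lt0 c (b :: B ++ L)) ?addr0 //.
  move=> x; rewrite -cat_cons mem_cat => /orP[/cB->|/cL->] //.
by rewrite raddfB /= cv (cB b) ?mem_head.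
Qed.

Lemma kpf_layer1 (c : {additive V -> int}) B L k v :
  {in B, forall b, c b = 1} -> {in L, forall b, c b = 0} -> c v = 1 ->
  kpf (B ++ L) k v = if k is k'.+1 then \sum_(b <- B) kpf L k' (v - b) else 0.
Proof.
move=> + cL cv; elim: B k => /= [|b B IHB] k cB.
  by rewrite (kpf_neq0 c) ?cv //; case: k => // k; rewrite big_nil.
have cB' : {in B, forall b, c b = 1} by move=> x xB; rewrite cB ?inE ?xB ?orbT.
case: k => [|k]; first by rewrite kpf_cons0 IHB.
rewrite kpf_consS IHB // big_cons addrC -cat_cons (kpf_layer0 c) //.
by rewrite raddfB /= cv (cB b) ?mem_head.
Qed.

(** Once the head [b] of [B] is used, one more root of [B] is due and [b] is still available, hence
    pairs with repetition. *)
Lemma kpf_layer2 (c : {additive V -> int}) B L k v :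
  {in B, forall b, c b = 1} -> {in L, forall b, c b = 0} -> c v = 2 ->
  kpf (B ++ L) k v
    = if k is k'.+2 then sum_pairs (fun w => kpf L k' (v - w)) B else 0.
Proof.
move=> + cL cv; elim: B k => /= [|b B IHB] k cB.
  by rewrite (kpf_neq0 c) ?cv //; case: k => [|[]].
have cB' : {in B, forall b, c b = 1} by move=> x xB; rewrite cB ?inE ?xB ?orbT.
case: k => [|k]; first by rewrite kpf_cons0 IHB.
rewrite kpf_consS IHB // -cat_cons (kpf_layer1 c) //; last first.
  by rewrite raddfB /= cv (cB b) ?mem_head.
case: k => [|k]; rewrite // addrC; congr (_ + _).
by apply: eq_bigr => x _; rewrite opprD addrA.
Qed.

End KostantPartitionFunction.

Arguments kpf {V} L _ _ : simpl never.
Arguments sum_pairs {V} f B.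
Arguments multisets {V I} g N s k v.

(* The pair (D_n, S_n), see tails_count. *)
Fixpoint open_pairs (n : nat) : {poly int} * {poly int} :=
  if n is n'.+1 then
    ((1 + 2 * 'X) * (open_pairs n').1 + 'X^2 * (open_pairs n').2 + 2,
     'X * (open_pairs n').1 + (1 + 'X^2) * (open_pairs n').2 + 1)
  else ((2 + 'X) ^+ 2, 2 + 2 * 'X + 'X^2).

(** This is F_n: a single root comes in from e_(n+1). For n = 0 each of the two end nodes is either
    covered by it or takes its own simple root, whence (1 + q)^2. *)
Definition open_single (n : nat) : {poly int} :=
  if n is n'.+1 then 'X * (open_pairs n').1 + 'X^2 * (open_pairs n').2 + 1
  else (1 + 'X) ^+ 2.

(** * Partial partitions along the chain towards the fork *)

Section Tails.
Variables (V : zmodType) (e : nat -> V) (b : V).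

(* The coefficients of the highest root on the nodes e_n, ..., e_0 and b. *)
Fixpoint top (n : nat) : V :=
  if n is n'.+1 then e n *+ 2 + top n' else e 0 + b.

Arguments top : simpl never.

Lemma topS n : top n.+1 = e n.+1 *+ 2 + top n. Proof. by []. Qed.

(* The restrictions to the nodes e_n, ..., e_0 and b of the positive roots of
   coefficient 1 on the node e_(n+1). *)
Fixpoint tails (n : nat) : seq V :=
  if n is n'.+1 then 0 :: top n :: [seq e n + x | x <- tails n']
  else [:: 0; e 0; b; e 0 + b].

(* The positive roots supported on e_n, ..., e_0 and b, grouped by the first
   node of their support. *)
Fixpoint layers (n : nat) : seq V :=
  if n is n'.+1 then [seq e n + x | x <- tails n'] ++ layers n'
  else [:: e 0; b].

Arguments tails : simpl never.
Arguments layers : simpl never.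

Lemma tailsS n :
  tails n.+1 = 0 :: top n.+1 :: [seq e n.+1 + x | x <- tails n].
Proof. by []. Qed.

Lemma layersS n : layers n.+1 = [seq e n.+1 + x | x <- tails n] ++ layers n.
Proof. by []. Qed.

(* The coordinate functions of the basis e_M, ..., e_0, b. *)
Variables (c : nat -> {additive V -> int}) (cb : {additive V -> int}) (M : nat).
Hypothesis c_e :
  forall n m, (n <= M)%N -> (m <= M)%N -> c n (e m) = (n == m)%:R.
Hypothesis c_b : forall n, (n <= M)%N -> c n b = 0.
Hypothesis cb_e : cb (e 0) = 0.
Hypothesis cb_b : cb b = 1.

Lemma c_top n m : (n < m <= M)%N -> c m (top n) = 0.
Proof.
elim: n => [|n IHn] /andP[ltnm leM].
  by rewrite raddfD /= c_e ?c_b ?gtn_eqF ?addr0.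
rewrite topS raddfD raddfMn /= c_e //; last exact/ltnW/(leq_trans ltnm).
by rewrite gtn_eqF // mul0rn add0r IHn // ltnW.
Qed.

Lemma c_topS n : (n < M)%N -> c n.+1 (top n.+1) = 2.
Proof.
by move=> ltM; rewrite topS raddfD raddfMn /= c_e // eqxx c_top ?addr0 ?ltnSn.
Qed.

Lemma c_tails n m : (n < m <= M)%N -> {in tails n, forall x, c m x = 0}.
Proof.
elim: n => [|n IHn] /andP[ltnm leM] x.
  rewrite !inE => /or4P[]/eqP->; rewrite ?raddf0 ?raddfD //= ?c_b //.
    by rewrite c_e ?gtn_eqF.
  by rewrite c_e ?gtn_eqF ?addr0.
rewrite !inE => /or3P[/eqP->|/eqP->|/mapP[y yt ->]]; first by rewrite raddf0.
  by rewrite c_top // ltnm.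
rewrite raddfD /= c_e //; last exact/ltnW/(leq_trans ltnm).
by rewrite gtn_eqF // add0r IHn // ltnW.
Qed.

Lemma c_layers n m : (n < m <= M)%N -> {in layers n, forall x, c m x = 0}.
Proof.
elim: n => [|n IHn] /andP[ltnm leM] x.
  by rewrite !inE => /orP[]/eqP->; rewrite ?c_b // c_e // gtn_eqF.
rewrite mem_cat => /orP[/mapP[y yt ->]|]; last by apply: IHn; rewrite ltnW.
rewrite raddfD /= c_e //; last exact/ltnW/(leq_trans ltnm).
by rewrite gtn_eqF // add0r (c_tails n) // ltnW.
Qed.

Lemma c_layer n : (n < M)%N ->
  {in [seq e n.+1 + x | x <- tails n], forall x, c n.+1 x = 1}.
Proof.
move=> ltM x /mapP[y yt ->].
by rewrite raddfD /= c_e // eqxx (c_tails n) ?ltnSn ?addr0.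
Qed.

Lemma c_layersS_ge0 n : (n < M)%N -> {in layers n.+1, forall x, 0 <= c n.+1 x}.
Proof.
move=> ltM x; rewrite mem_cat => /orP[/(c_layer _ ltM)->//|].
by move/(c_layers n n.+1) ->; rewrite ?ltnSn.
Qed.

(** In [tails n.+1] the coefficient on e_(n+1) is 0 for the first entry, 2 for [top] and 1 for the
    others, which separates the three groups. *)
Lemma uniq_tails n : (n <= M)%N -> uniq (tails n).
Proof.
elim: n => [|n IHn] ltM.
  apply: (@map_uniq _ _ (fun x => (c 0 x, cb x))).
  by rewrite /= !raddfD !raddf0 /= cb_e cb_b c_e ?c_b.
have xS x : x \in [seq e n.+1 + y | y <- tails n] -> c n.+1 x = 1.
  exact: c_layer.
rewrite tailsS !cons_uniq inE negb_or (map_inj_uniq (addrI _)).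
rewrite IHn ?(ltnW ltM) // andbT -andbA; apply/and3P; split.
- by apply: contra_eq_neq (c_topS _ ltM) => <-; rewrite raddf0.
- by apply/negP => /xS; rewrite raddf0.
- by apply/negP => /xS; rewrite c_topS.
Qed.

Lemma uniq_layers n : (n <= M)%N -> uniq (layers n).
Proof.
elim: n => [|n IHn] ltM.
  apply: (@map_uniq _ _ (c 0)).
  by rewrite /= c_e ?c_b.
rewrite layersS cat_uniq (map_inj_uniq (addrI _)) uniq_tails ?(ltnW ltM) //=.
rewrite IHn ?(ltnW ltM) // andbT; apply/hasPn => x xL; apply/negP.
move=> /(c_layer _ ltM); rewrite (c_layers n) //.
by rewrite ltnSn.
Qed.

Lemma kpf_layersS0 n k v : (n < M)%N -> c n.+1 v = 0 ->
  kpf (layers n.+1) k v = kpf (layers n) k v.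
Proof.
move=> ltM cv; apply: (kpf_layer0 _ (c n.+1)) => //; first exact: c_layer.
by apply: c_layers; rewrite ltnSn.
Qed.

Lemma kpf_layersS1 n k v : (n < M)%N -> c n.+1 v = 1 ->
  kpf (layers n.+1) k v = if k is k'.+1 then
    \sum_(x <- tails n) kpf (layers n) k' (v - (e n.+1 + x)) else 0.
Proof.
move=> ltM cv; rewrite (kpf_layer1 _ (c n.+1)) //.
- by case: k => // k; rewrite big_map.
- exact: c_layer.
- by apply: c_layers; rewrite ltnSn.
Qed.

Lemma kpf_layersS2 n k v : (n < M)%N -> c n.+1 v = 2 ->
  kpf (layers n.+1) k v = if k is k'.+2 then
    sum_pairs (fun w => kpf (layers n) k' (v - (e n.+1 *+ 2 + w))) (tails n)
    else 0.
Proof.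
move=> ltM cv; rewrite (kpf_layer2 _ (c n.+1)) //.
- by case: k => [|[|k]] //; rewrite sum_pairs_shift.
- exact: c_layer.
- by apply: c_layers; rewrite ltnSn.
Qed.

Lemma kpf_layersS_lt0 n k v : (n < M)%N -> c n.+1 v < 0 ->
  kpf (layers n.+1) k v = 0.
Proof.
by move=> ltM cv; apply: (kpf_lt0 _ (c n.+1)) => //; apply: c_layersS_ge0.
Qed.

Lemma kpf_single (d : {additive V -> int}) x k j : d x = 1 ->
  kpf [:: x] k (x - x *+ j) = (k + j == 1)%N%:R.
Proof.
move=> dx; have dx1 : {in [:: x], forall y, d y = 1} by move=> y /[!inE]/eqP->.
have d0 : {in [::], forall y, d y = 0} by [].
have dv : d (x - x *+ j) = 1 - j%:R by rewrite raddfB raddfMn /= dx.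
case: j dv => [|[|j]] dv.
- rewrite subr0 addn0 -[[:: x]]cats0 (kpf_layer1 _ d) //.
  by case: k => // k; rewrite big_seq1 subrr kpf_nil eqxx andbT.
- rewrite subrr -[[:: x]]cats0 (kpf_layer0 _ d) ?raddf0 // kpf_nil eqxx andbT.
  by rewrite addn1.
- rewrite (kpf_lt0 _ d); first by rewrite !addnS.
    by move=> y /dx1->.
  by rewrite dv; lia.
Qed.

(** Here [i] and [j] tell how often e_0 and b are already covered. An uncovered node needs its
    simple root, a node covered once is finished, and an excess admits no completion. *)
Lemma kpf_fork k i j : kpf [:: e 0; b] k (e 0 + b - (e 0 *+ i + b *+ j))
  = [&& k + i + j == 2, i <= 1 & j <= 1]%N%:R.
Proof.
have c0e : {in [:: e 0], forall x, c 0 x = 1}.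
  by move=> x /[!inE]/eqP->; rewrite c_e.
have c0b : {in [:: b], forall x, c 0 x = 0}.
  by move=> x /[!inE]/eqP->; rewrite c_b.
have c0v : c 0 (e 0 + b - (e 0 *+ i + b *+ j)) = 1 - i%:R.
  by rewrite raddfB !raddfD !raddfMn /= !c_e // c_b // mul0rn !addr0.
rewrite -[[:: e 0; b]]/([:: e 0] ++ [:: b]).
case: i c0v => [|[|i]] c0v.
- rewrite (kpf_layer1 _ (c 0)) //; case: k => [|k].
    by case: j c0v => [|[|[|j]]].
  rewrite big_seq1 mulr0n add0r addrAC [e 0 + b]addrC addrK (kpf_single cb) //.
  by congr (_%:R); lia.
- rewrite (kpf_layer0 _ (c 0)) // mulr1n [e 0 + b]addrC opprD addrA addrK.
  by rewrite (kpf_single cb) //; congr (_%:R); lia.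
- rewrite (kpf_lt0 _ (c 0)) ?andbF //.
    by move=> x; rewrite mem_cat => /orP[/c0e->|/c0b->].
  by rewrite c0v; lia.
Qed.

Lemma kpf_layers_zero n k : (n <= M)%N -> kpf (layers n) k 0 = (k == 0%N)%:R.
Proof.
elim: n => [|n IHn] leM.
  have := kpf_fork k 1 1; rewrite !mulr1n subrr andbT => ->.
  by congr (_%:R); lia.
by rewrite kpf_layersS0 ?raddf0 ?IHn // ltnW.
Qed.

Section Step.
Variables (n k : nat).
Hypothesis ltM : (n < M)%N.
(** Completions to [top n] by [k] new roots, where [w] is the sum of the tails of the incoming
    roots. *)
Let f n k w := kpf (layers n) k (top n - w).

Let c_etail x : x \in tails n -> c n.+1 (e n.+1 + x) = 1.
Proof. by move=> xt; apply: c_layer => //; apply: map_f. Qed.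

(** Nothing covers e_(n+1), which has coefficient 2, so two new roots start there. *)
Lemma kpf_tail0 :
  f n.+1 k 0 = if k is k'.+2 then sum_pairs (f n k') (tails n) else 0.
Proof.
rewrite /f subr0 kpf_layersS2 ?c_topS //; case: k => [|[|k']] //.
by apply: eq_sum_pairs => x y _ _; rewrite topS opprD addrACA subrr add0r.
Qed.

(** The node e_(n+1) is covered once, so exactly one new root starts there and accompanies the tail
    [x]. *)
Lemma kpf_tail1 x : x \in tails n -> f n.+1 k (e n.+1 + x)
  = if k is k'.+1 then \sum_(y <- tails n) f n k' (x + y) else 0.
Proof.
move=> xt; rewrite /f kpf_layersS1 //; last first.
  by rewrite raddfB /= c_topS ?c_etail.
case: k => // k'; apply: eq_bigr => y _; congr (kpf _ _ _).
by rewrite -addrA -opprD addrACA -mulr2n topS opprD addrACA subrr add0r.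
Qed.

Lemma kpf_tail2 x y : x \in tails n -> y \in tails n ->
  f n.+1 k (e n.+1 + x + (e n.+1 + y)) = f n k (x + y).
Proof.
move=> xt yt; rewrite /f kpf_layersS0 //.
  by rewrite addrACA -mulr2n topS opprD addrACA subrr add0r.
by rewrite raddfB /= c_topS // raddfD /= !c_etail.
Qed.

Lemma kpf_tail_top : f n.+1 k (top n.+1) = (k == 0%N)%:R.
Proof. by rewrite /f subrr kpf_layers_zero. Qed.

Lemma kpf_tail_top2 : f n.+1 k (top n.+1 + top n.+1) = 0.
Proof.
by rewrite /f kpf_layersS_lt0 // raddfB /= c_topS // raddfD /= c_topS.
Qed.

(** The sum has coefficient 3 on e_(n+1), where only 2 is allowed. *)
Lemma kpf_tail_topl x : x \in tails n -> f n.+1 k (top n.+1 + (e n.+1 + x)) = 0.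
Proof.
move=> xt; rewrite /f kpf_layersS_lt0 // raddfB /= c_topS //.
by rewrite raddfD /= c_topS ?c_etail.
Qed.

End Step.

(** Distinguishable incoming roots give ordered pairs of tails (D_n), equal ones unordered pairs
    (S_n), and a single one gives F_n. The induction sorts the entries of [tails n.+1]: a root stops
    (0), doubles ([top]) or continues. *)
Lemma tails_count n : (n <= M)%N -> forall k,
  [/\ \sum_(x <- tails n) \sum_(y <- tails n) kpf (layers n) k (top n - (x + y))
    = (open_pairs n).1`_k,
  sum_pairs (fun w => kpf (layers n) k (top n - w)) (tails n)
    = (open_pairs n).2`_k &
  \sum_(x <- tails n) kpf (layers n) k (top n - x) = (open_single n)`_k].
Proof.
elim: n => [_|n IHn ltM] k.
  (* Written with explicit multiplicities, all the sums of tails at the fork are evaluated by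
     [kpf_fork]. *)
  have -> : tails 0 = [:: e 0 *+ 0 + b *+ 0; e 0 *+ 1 + b *+ 0;
                          e 0 *+ 0 + b *+ 1; e 0 *+ 1 + b *+ 1].
    by rewrite !mulr0n !mulr1n !addr0 add0r.
  have E i j i' j' : e 0 *+ i + b *+ j + (e 0 *+ i' + b *+ j')
                     = e 0 *+ (i + i') + b *+ (j + j').
    by rewrite !mulrnDr addrACA.
  have F i j : kpf (layers 0) k (top 0 - (e 0 *+ i + b *+ j))
      = (if (i <= 1)%N && (j <= 1)%N then 'X^(2 - i - j)
         else 0 : {poly int})`_k.
    rewrite /layers kpf_fork.
    case: ifP => [/andP[i1 j1]|_]; last by rewrite andbF coef0.
    by rewrite coefXn andbT; congr (_%:R); lia.
  rewrite [sum_pairs _ _]/= !big_cons !big_nil !E !F /=.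
  rewrite !(addn0, add0n, addnn) !subSS !subn0 !coef0 !(addr0, add0r) -!coefD.
  by split; congr ((_ : {poly int})`_k); ring.
have IHD k' := let: And3 h _ _ := IHn (ltnW ltM) k' in h.
have IHS k' := let: And3 _ h _ := IHn (ltnW ltM) k' in h.
(* [T0], [T1] and [T2] are the contributions when the covered part is 0, e_(n+1) + x or [top]; [Z1]
   and [Z2] are the combinations that exceed coefficient 2. *)
have T0 : kpf (layers n.+1) k (top n.+1 - 0) = ('X^2 * (open_pairs n).2)`_k.
  rewrite kpf_tail0 // coefXnM; case: k => [|[|k]] //=.
  by rewrite !subSS subn0 IHS.
have T1 : \sum_(x <- tails n) kpf (layers n.+1) k (top n.+1 - (e n.+1 + x))
    = ('X * (open_pairs n).1)`_k.
  under eq_big_seq => x xt do rewrite kpf_tail1 //.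
  by rewrite coefXM; case: (k) => [|k'] /=; [rewrite big1|rewrite IHD].
have T2 : kpf (layers n.+1) k (top n.+1 - top n.+1) = (1 : {poly int})`_k.
  by rewrite kpf_tail_top // coef1.
have Z2 := kpf_tail_top2 n k ltM.
have Z1 : \sum_(x <- tails n)
    kpf (layers n.+1) k (top n.+1 - (top n.+1 + (e n.+1 + x))) = 0.
  by rewrite big_seq big1 // => x xt; rewrite kpf_tail_topl.
set g := fun w => kpf (layers n.+1) k (top n.+1 - w).
(* The first root continues: a second root that stops gives q D_n, one that continues gives D_n, and
   [top] gives nothing. *)
have T3 : \sum_(x <- tails n) \sum_(y <- tails n.+1) g (e n.+1 + x + y)
    = ('X * (open_pairs n).1)`_k + (open_pairs n).1`_k.
  rewrite -T1 -IHD -big_split; apply: eq_big_seq => x xt /=.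
  rewrite tailsS !big_cons big_map addr0 [_ + top n.+1]addrC /g.
  rewrite kpf_tail_topl // add0r; congr (_ + _).
  by apply: eq_big_seq => y yt; rewrite kpf_tail2.
have T01 : \sum_(x <- tails n) g (0 + (e n.+1 + x))
    = ('X * (open_pairs n).1)`_k.
  by rewrite -T1; apply: eq_bigr => x _; rewrite add0r.
split.
- rewrite tailsS 2!big_cons big_map -tailsS T3 tailsS !big_cons !big_map T01.
  rewrite Z1 Z2 !addr0 add0r T0 T2 -!coefD.
  by congr ((_ : {poly int})`_k); rewrite [RHS]/=; ring.
- rewrite tailsS [sum_pairs _ _]/= !big_cons !big_map T01 /g Z1 Z2.
  rewrite sum_pairs_shift.
  rewrite (eq_sum_pairs _ _ (fun w => kpf (layers n) k (top n - w))).
  2: move=> x y xt yt; rewrite -(kpf_tail2 n k) //.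
  2: by rewrite (addrACA (e n.+1) x) -mulr2n.
  rewrite IHS !addr0 !add0r T0 T2 -!coefD.
  by congr ((_ : {poly int})`_k); rewrite [RHS]/=; ring.
- rewrite tailsS !big_cons big_map T0 T1 T2 -!coefD.
  by congr ((_ : {poly int})`_k); rewrite [RHS]/=; ring.
Qed.

End Tails.

Arguments top {V} e b n.
Arguments tails {V} e b n.
Arguments layers {V} e b n.

(** * Coordinates, the highest root and the positive roots of D_r *)

Definition root_coord (r i : nat) (v : 'rV[int]_r) : int :=
  \sum_(m < r) (m.+1 == i)%:R * v 0 m.

Lemma root_coord_is_zmod_morphism r i : zmod_morphism (root_coord r i).
Proof.
move=> u v; rewrite /root_coord -sumrB.
by apply: eq_bigr => m _; rewrite !mxE mulrBr.
Qed.

HB.instance Definition _ r i := GRing.isZmodMorphism.Build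
  'rV[int]_r int (root_coord r i) (root_coord_is_zmod_morphism r i).

Lemma root_coord_alpha r i j :
  (0 < i <= r)%N -> root_coord r i (alpha r j) = (i == j)%:R.
Proof.
case: i => // i /= lt_ir; rewrite /root_coord (bigD1 (Ordinal lt_ir)) //=.
rewrite mxE eqxx mul1r big1 ?addr0 // => m.
by rewrite eqSS -val_eqE /= => /negPf->; rewrite mul0r.
Qed.

Section HighestRoot.
Variable r : nat.
Hypothesis r_ge4 : (4 <= r)%N.

Let e n := alpha r (r.-1 - n).
Let b := alpha r r.

Let c_e n m : (n <= r - 2)%N -> (m <= r - 2)%N ->
  root_coord r (r.-1 - n) (e m) = (n == m)%:R.
Proof.
by move=> ? ?; rewrite root_coord_alpha; [congr (_%:R); lia|lia].
Qed.

Let c_b n : (n <= r - 2)%N -> root_coord r (r.-1 - n) b = 0.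
Proof.
move=> ?; rewrite root_coord_alpha; last by lia.
by rewrite (_ : _ == _ = false) //; lia.
Qed.

Let cb_e : root_coord r r (e 0) = 0.
Proof.
rewrite root_coord_alpha; last by lia.
by rewrite (_ : _ == _ = false) //; lia.
Qed.

Let cb_b : root_coord r r b = 1.
Proof. by rewrite root_coord_alpha ?eqxx //; lia. Qed.

Let asum i j := \sum_(i <= m < j) alpha r m.

Lemma topE n : (n <= r - 2)%N -> top e b n
  = \sum_(r.-1 - n <= m < r.-1) alpha r m *+ 2 + alpha r r.-1 + alpha r r.
Proof.
elim: n => [|n IHn] len; first by rewrite subn0 big_geq // add0r /top /e subn0.
rewrite topS IHn; last by lia.
rewrite [in RHS]big_ltn; last by lia.
by rewrite (_ : (r.-1 - n.+1).+1 = r.-1 - n)%N ?addrA //; lia.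
Qed.

(** The coefficient on alpha_1 = e_(r-2) is 1, so a single root starts there; the nodes from e_(r-3)
    on carry [top]. *)
Lemma highest_rootDE : highest_rootD r = e (r - 2) + top e b (r - 3).
Proof.
rewrite topE; last by lia.
rewrite /highest_rootD /e !addrA.
rewrite (_ : r.-1 - (r - 2) = 1)%N; last by lia.
by rewrite (_ : r.-1 - (r - 3) = 2)%N //; lia.
Qed.

(* The members of tails (r.-1 - i) in the notation of posrootsD. *)
Definition tail_spec i (x : 'rV[int]_r) : Prop :=
  [\/ exists2 j, (i <= j <= r)%N & x = asum i j,
      x = asum i r.-1 + alpha r r,
      x = asum i r.-1 + alpha r r.-1 + alpha r r |
      exists2 j, (i <= j < r.-1)%N &
        x = asum i j + \sum_(j <= m < r.-1) alpha r m *+ 2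
            + alpha r r.-1 + alpha r r].

(** This mirrors [tailsS]: j = i gives 0 in the first family and the fully doubled tail in the last;
    all other members begin with alpha_i. *)
Lemma tail_specS i x : (i < r.-1)%N -> tail_spec i x <->
  [\/ x = 0,
      x = \sum_(i <= m < r.-1) alpha r m *+ 2 + alpha r r.-1 + alpha r r |
      exists2 y, tail_spec i.+1 y & x = alpha r i + y].
Proof.
move=> ltir; have asumS j : (i < j)%N -> asum i j = alpha r i + asum i.+1 j.
  by move=> ltij; rewrite /asum big_ltn.
have asum0 : asum i i = 0 by rewrite /asum big_geq.
split.
  case=> [[j]|->|->|[j]].
  - rewrite leq_eqVlt => /andP[/orP[/eqP<- _|ltij jr]] ->.
      by apply: Or31; rewrite asum0.
    apply: Or33; exists (asum i.+1 j); last by rewrite asumS.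
    by apply: Or41; exists j; rewrite ?ltij.
  - apply: Or33; exists (asum i.+1 r.-1 + alpha r r); first exact: Or42.
    by rewrite asumS // addrA.
  - apply: Or33; exists (asum i.+1 r.-1 + alpha r r.-1 + alpha r r).
      exact: Or43.
    by rewrite asumS // !addrA.
  - rewrite leq_eqVlt => /andP[/orP[/eqP<- _|ltij jr]] ->.
      by apply: Or32; rewrite asum0 add0r.
    apply: Or33; exists (asum i.+1 j + \sum_(j <= m < r.-1) alpha r m *+ 2
              + alpha r r.-1 + alpha r r); last by rewrite asumS // !addrA.
    by apply: Or44; exists j; rewrite ?ltij.
case=> [->|->|[y + ->]].
- by apply: Or41; exists i; [lia|rewrite asum0].
- by apply: Or44; exists i; [lia|rewrite asum0 add0r].
case=> [[j jP]|->|->|[j jP]].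
- by move=> ->; apply: Or41; exists j; [lia|rewrite asumS //; lia].
- by apply: Or42; rewrite asumS ?addrA.
- by apply: Or43; rewrite asumS ?addrA.
- by move=> ->; apply: Or44; exists j; [lia|rewrite asumS ?addrA //; lia].
Qed.

Lemma tail_spec_fork x : tail_spec r.-1 x <-> x \in tails e b 0.
Proof.
have asum0 : asum r.-1 r.-1 = 0 by rewrite /asum big_geq.
have asum1 : asum r.-1 r = alpha r r.-1.
  by rewrite /asum big_ltn ?big_geq ?addr0 //; lia.
rewrite !inE /e subn0; split.
  case=> [[j jP ->]|->|->|[j jP]]; last by lia.
  - have [->|->] : j = r.-1 \/ j = r by lia.
      by rewrite asum0 eqxx.
    by rewrite asum1 eqxx orbT.
  - by rewrite asum0 add0r eqxx !orbT.
  - by rewrite asum0 add0r eqxx !orbT.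
case/or4P=> /eqP->.
- by apply: Or41; exists r.-1; [lia|rewrite asum0].
- by apply: Or41; exists r; [lia|rewrite asum1].
- by apply: Or42; rewrite asum0 add0r.
- by apply: Or43; rewrite asum0 add0r.
Qed.

Lemma mem_tails n x : (n <= r - 2)%N ->
  tail_spec (r.-1 - n) x <-> x \in tails e b n.
Proof.
elim: n x => [|n IHn] x len; first by rewrite subn0 tail_spec_fork.
rewrite tail_specS; last by lia.
rewrite tailsS !inE topE // (_ : (r.-1 - n.+1).+1 = r.-1 - n)%N; last by lia.
split=> [[->|->|[y yt ->]]|/or3P[/eqP->|/eqP->|/mapP[y yt ->]]].
- by rewrite eqxx.
- by rewrite eqxx orbT.
- by rewrite (map_f (+%R (e n.+1))) ?orbT // -IHn //; lia.
- exact: Or31.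
- exact: Or32.
- by apply: Or33; exists y => //; rewrite IHn //; lia.
Qed.

Lemma mem_layers n x : (n <= r - 2)%N -> x \in layers e b n <->
  [\/ x = alpha r r.-1, x = alpha r r |
      exists i y, [/\ (r.-1 - n <= i < r.-1)%N, tail_spec i.+1 y
                    & x = alpha r i + y]].
Proof.
elim: n => [|n IHn] len.
  rewrite !inE /e subn0; split=> [/orP[]/eqP->|[->|->|[i [y [iP]]]]].
  - exact: Or31.
  - exact: Or32.
  - by rewrite eqxx.
  - by rewrite eqxx orbT.
  - by lia.
have iS : (r.-1 - n.+1).+1 = (r.-1 - n)%N by lia.
rewrite layersS mem_cat; split=> [|H].
  case/orP=> [/mapP[y yt ->]|].
    apply: Or33; exists (r.-1 - n.+1)%N, y; split=> //; first by lia.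
    by rewrite iS mem_tails //; lia.
  rewrite IHn; last by lia.
  case=> [->|->|[i [y [iP yt ->]]]]; [exact: Or31|exact: Or32|].
  by apply: Or33; exists i, y; split=> //; lia.
have len' : (n <= r - 2)%N by lia.
have [_ mem_n] := IHn len'; apply/orP.
case: H mem_n => [->|->|[i [y [iP yt ->]]]] mem_n.
- by right; apply: mem_n; apply: Or31.
- by right; apply: mem_n; apply: Or32.
have [ei|ltni] : i = (r.-1 - n.+1)%N \/ (r.-1 - n <= i)%N by lia.
  by left; apply/mapP; exists y; rewrite ?ei // -mem_tails // -iS -ei.
right; apply: mem_n; apply: Or33; exists i, y; split=> //; lia.
Qed.

(** Apart from alpha_(r-1) and alpha_r, a positive root is given by its first node i and its tail on
    the later nodes; the four kinds of tail match the four indexed families of [posrootsD]. *)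
Lemma mem_layers_posrootsD : layers e b (r - 2) =i posrootsD r.
Proof.
move=> x; apply/idP/idP.
  rewrite mem_layers // !mem_cat !inE.
  case=> [->|->|[i [y [iP yt ->]]]].
  - apply/orP; left; apply/allpairsPdep; exists r.-1, r.-1.
    rewrite !mem_index_iota big_ltn ?big_geq ?addr0 //.
    by split=> //; lia.
  - by rewrite eqxx orbT.
  have asumS j : (i < j)%N ->
      alpha r i + asum i.+1 j = \sum_(i <= m < j) alpha r m.
    by move=> ltij; rewrite [RHS]big_ltn.
  have i_in : i \in index_iota 1 r.-1 by rewrite mem_index_iota; lia.
  have i_in' : i \in index_iota 1 r by rewrite mem_index_iota; lia.
  have lti : (i < r.-1)%N by lia.
  case: yt => [[j jP ->]|->|->|[j jP ->]]; rewrite ?addrA asumS //; try lia.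
  (* [asum] excludes its upper end while [posrootsD] includes it, hence [j.-1]. *)
  - apply/or4P/Or41/allpairsPdep; exists i, j.-1.
    by rewrite i_in' mem_index_iota (_ : j.-1.+1 = j); [split=> //; lia|lia].
  - by apply/or4P/Or43/mapP; exists i.
  - by apply/or4P/Or44/orP; left; apply/mapP; exists i.
  - apply/or4P/Or44/orP; right; apply/allpairsPdep; exists i, j.
    by rewrite i_in mem_index_iota; split=> //; lia.
rewrite mem_layers // !mem_cat inE.
have asumS i j : (i < j)%N ->
    \sum_(i <= m < j) alpha r m = alpha r i + asum i.+1 j.
  by move=> ltij; rewrite big_ltn.
case/or4P=> [|/eqP->|/mapP[i]|/orP[/mapP[i]|]].
- case/allpairsPdep=> i [j [+ + ->]]; rewrite !mem_index_iota => iP jP.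
  (* For i = r - 1 only the simple root alpha_(r-1) remains, which [layers] lists at the fork. *)
  have [ei|lti] : i = r.-1 \/ (i < r.-1)%N by lia.
    apply: Or31; rewrite (_ : j = i); last by lia.
    by rewrite big_ltn // big_geq // addr0 ei.
  apply: Or33; exists i, (asum i.+1 j.+1).
  split; [lia| |by rewrite asumS //; lia].
  by apply: Or41; exists j.+1 => //; lia.
- exact: Or32.
- rewrite mem_index_iota => iP ->.
  apply: Or33; exists i, (asum i.+1 r.-1 + alpha r r).
  split; [lia|exact: Or42|].
  by rewrite asumS ?addrA //; lia.
- rewrite mem_index_iota => iP ->.
  apply: Or33; exists i, (asum i.+1 r.-1 + alpha r r.-1 + alpha r r).
  by split; [lia|exact: Or43|rewrite asumS ?addrA //; lia].
- case/allpairsPdep=> i [j [+ + ->]]; rewrite !mem_index_iota => iP jP.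
  apply: Or33; exists i, (asum i.+1 j + \sum_(j <= m < r.-1) alpha r m *+ 2
                            + alpha r r.-1 + alpha r r).
  split; [lia| |by rewrite asumS ?addrA //; lia].
  by apply: Or44; exists j => //; lia.
Qed.

(** The list [s] enumerates [seq_sub (posrootsD r)] in the order of [layers], so that
    [card_multisets] applies with N = k. *)
Lemma card_partitionsD k :
  #|partitionsD r k|%:R = kpf (layers e b (r - 2)) k (highest_rootD r).
Proof.
set L := layers e b (r - 2).
pose s : seq (seq_sub (posrootsD r)) := pmap insub L.
have valL : [seq ssval i | i <- s] = L.
  rewrite (pmap_filter (@insubK _ _ _)); apply/all_filterP/allP => x xL.
  by rewrite isSome_insub -mem_layers_posrootsD.
have uL : uniq L.
  by apply: (uniq_layers _ _ _ (fun n => root_coord r (r.-1 - n))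
                          (root_coord r r) (r - 2)).
have us : uniq s by rewrite -(map_inj_uniq val_inj) valL.
rewrite -valL -(card_multisets _ _ _ k) //; congr (_%:R); apply: eq_card => m.
(* Since [s] exhausts the type, the support condition always holds. *)
rewrite !inE; case: forallP => // -[]; move=> i; apply/implyP.
by rewrite mem_pmap_sub mem_layers_posrootsD (ssvalP i).
Qed.

(** The one root involving alpha_1 contributes the factor q; summing over its tails leaves the third
    sum of [tails_count]. *)
Lemma card_partitionsDE k :
  #|partitionsD r k|%:R = ('X * open_single (r - 3))`_k :> int.
Proof.
rewrite card_partitionsD highest_rootDE.
rewrite (_ : (r - 2 = (r - 3).+1)%N); last by lia.
have ltr3 : (r - 3 < r - 2)%N by lia.
have e_top : root_coord r (r.-1 - (r - 3).+1)
    (e (r - 3).+1 + top e b (r - 3)) = 1.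
  rewrite raddfD /= c_e ?eqxx; try by lia.
  rewrite (c_top _ _ _ (fun n => root_coord r (r.-1 - n)) (r - 2)) ?addr0 //.
  by rewrite ltnSn.
rewrite (kpf_layersS1 _ _ _ (fun n => root_coord r (r.-1 - n)) (r - 2)) //.
rewrite coefXM; case: k => [|k] //=.
have [|_ _ <-] := tails_count _ _ _ (fun n => root_coord r (r.-1 - n))
    (root_coord r r) (r - 2) c_e c_b cb_e cb_b (r - 3) _ k; first exact: ltnW.
by apply: eq_bigr => x _; rewrite opprD addrACA subrr add0r.
Qed.

Lemma kostantDE : kostantD r = 'X * open_single (r - 3).
Proof.
apply/polyP => k; rewrite -card_partitionsDE /kostantD coef_sum.
rewrite (eq_bigr (fun i => if i == k then #|partitionsD r i|%:R else 0)).
  (* Outside the range of summation the coefficient is zero: for k = 0 by the factor q, for k > 2r -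
     3 by the height bound. *)
  rewrite -big_mkcond big_nat1_eq; case: ifPn => //; rewrite negb_and -leqNgt.
  case/orP=> [|lek]; last by rewrite partitionsD_eq0 ?cards0 //; lia.
  by case: k => // _; rewrite card_partitionsDE coefXM.
move=> i _; rewrite mulr_natl coefMn coefXn eq_sym.
by case: eqP; rewrite ?mul0rn.
Qed.

End HighestRoot.

(** * The recurrence and the rational generating function *)

Lemma open_single_rec n : open_single n.+3
  = (2 + 2 * 'X + 'X^2) * open_single n.+2
    - (1 + 2 * 'X + 'X^2 + 'X^3) * open_single n.+1.
Proof. by rewrite /=; ring. Qed.

Section FpsMul.
Variable R : comUnitRingType.
Implicit Types (p : {poly R}) (h : fps R).

Lemma fps_mul_polyD p1 p2 h n : fps_mul (fps_of_poly (p1 + p2)) h n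
  = fps_mul (fps_of_poly p1) h n + fps_mul (fps_of_poly p2) h n.
Proof.
rewrite /fps_mul -big_split; apply: eq_bigr => i _.
by rewrite /fps_of_poly coefD mulrDl.
Qed.

Lemma fps_mul_polyN p h n :
  fps_mul (fps_of_poly (- p)) h n = - fps_mul (fps_of_poly p) h n.
Proof.
rewrite /fps_mul -sumrN; apply: eq_bigr => i _.
by rewrite /fps_of_poly coefN mulNr.
Qed.

Lemma fps_mul_monomial a m h n : fps_mul (fps_of_poly (a%:P * 'X^m)) h n
  = if (m <= n)%N then a * h (n - m)%N else 0.
Proof.
rewrite /fps_mul /fps_of_poly.
rewrite (eq_bigr (fun i : 'I_n.+1 =>
                    if i == m :> nat then a * h (n - m)%N else 0)).
  by rewrite -big_mkcond (big_ord1_eq _ (fun=> a * h (n - m)%N)) ltnS.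
move=> i _; rewrite coefCM coefXn; case: eqP => [->|_]; rewrite ?mulr1 //.
by rewrite mulr0 mul0r.
Qed.

End FpsMul.

Theorem theorem5p3 :
  let q : {poly int} := 'X in
  let x : {poly {poly int}} := 'X in
  let num : {poly {poly int}} :=
    (q + 4 * q ^+ 2 + 6 * q ^+ 3 + 3 * q ^+ 4 + q ^+ 5)%:P * x ^+ 4
    - (q + 4 * q ^+ 2 + 6 * q ^+ 3 + 5 * q ^+ 4 + 3 * q ^+ 5 + q ^+ 6)%:P
        * x ^+ 5 in
  let den : {poly {poly int}} :=
    1 - (2 + 2 * q + q ^+ 2)%:P * x
    + (1 + 2 * q + q ^+ 2 + q ^+ 3)%:P * x ^+ 2 in
  (fun r : nat => if (4 <= r)%N then kostantD r else 0)
    =1 fps_div (fps_of_poly num) (fps_of_poly den).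
Proof.
move=> q x num den r; rewrite /fps_div.
set h := fps_inv (fps_of_poly den).
rewrite fps_mul_polyD fps_mul_polyN !fps_mul_monomial.
have den0 : fps_of_poly den 0 = 1.
  by rewrite /fps_of_poly !coefE /=; ring.
(* All terms are put in the form required by [fps_mul_monomial]. *)
have denE : den = 1%:P * x ^+ 0 - (2 + 2 * q + q ^+ 2)%:P * x ^+ 1
                  + (1 + 2 * q + q ^+ 2 + q ^+ 3)%:P * x ^+ 2.
  by rewrite expr0 expr1 mulr1.
have hE n : h n - (if (1 <= n)%N then (2 + 2 * q + q ^+ 2) * h (n - 1)%N else 0)
    + (if (2 <= n)%N then (1 + 2 * q + q ^+ 2 + q ^+ 3) * h (n - 2)%N else 0)
    = (n == 0%N)%:R.
  have := fps_mulfV (f := fps_of_poly den); rewrite den0 => /(_ (unitr1 _) n).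
  rewrite -/h denE.
  rewrite !fps_mul_polyD fps_mul_polyN !fps_mul_monomial /= subn0 mul1r => ->.
  by rewrite /fps_of_poly coef1.
have h0 : h 0%N = 1 by have := hE 0%N; rewrite /= subr0 addr0.
have h1 : h 1%N = 2 + 2 * q + q ^+ 2.
  by have /eqP := hE 1%N; rewrite /= addr0 subr_eq0 h0 mulr1 => /eqP.
have hS n : h n.+2 = (2 + 2 * q + q ^+ 2) * h n.+1
                     - (1 + 2 * q + q ^+ 2 + q ^+ 3) * h n.
  have := hE n.+2; rewrite /= !subSS !subn0 => /eqP.
  by rewrite addr_eq0 subr_eq => /eqP->; ring.
(* The coefficient of x^(n+4) on the right-hand side. The first bracket is q F_1, the second is q
   F_0 times the determinant 1 + 2q + q^2 + q^3. *)
pose rhs n := (q + 4 * q ^+ 2 + 6 * q ^+ 3 + 3 * q ^+ 4 + q ^+ 5) * h n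
  - (if n is n'.+1 then
       (q + 4 * q ^+ 2 + 6 * q ^+ 3 + 5 * q ^+ 4 + 3 * q ^+ 5 + q ^+ 6) * h n'
     else 0).
(* The recurrence has order two, so two consecutive values are carried along. *)
have rhsE n : 'X * open_single n.+1 = rhs n /\ 'X * open_single n.+2 = rhs n.+1.
  elim: n => [|n [IHn IHn1]].
    by rewrite /rhs h0 h1 /= -/q; split; ring.
  split=> //; rewrite open_single_rec mulrBr !(mulrCA 'X) IHn IHn1 /rhs -/q hS.
  by case: n {IHn IHn1} => [|n]; rewrite ?h0 ?h1 ?hS; ring.
(* For r < 4 no monomial of the numerator contributes, and both sides vanish. *)
case: (ltnP 3 r) => [r4|]; last by case: r => [|[|[|[]]]] //; rewrite subr0.
rewrite kostantDE // (_ : (r - 3 = (r - 4).+1)%N); last by lia.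
have [-> _] := rhsE (r - 4)%N; rewrite /rhs.
by case: r r4 => [|[|[|[|[|r]]]]] //= _; rewrite ?subSS ?subn0 ?subr0.
Qed.
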